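(* Let $\hat{\mathbb{Z}}^{j}_{\mathrm{cvx}}$, $j\ge 2$, be the convex-hull constraint estimates defined in the context. Suppose that for some $\bar j\in\{2,3,\dots\}$ the set $\hat{\mathbb{Z}}^{\bar j}_{\mathrm{cvx}}$ yields feasibility of the MPC problem; that is, with constraint estimate $\hat{\mathbb{Z}}^{\bar j}=\hat{\mathbb{Z}}^{\bar j}_{\mathrm{cvx}}$ and its corresponding terminal set, the MPC problem is feasible at time $t=0$ of iteration $\bar j$ (i.e. from the initial state $x_S$). Then $$\hat{\mathbb{Z}}^{\bar j}_{\mathrm{cvx}}\subseteq\mathbb{Z},$$ and, with the iterations $j\ge\bar j$ run using $\hat{\mathbb{Z}}^j=\hat{\mathbb{Z}}^j_{\mathrm{cvx}}$, one has $\hat{\mathbb{Z}}^{j}_{\mathrm{cvx}}=\hat{\mathbb{Z}}^{\bar j}_{\mathrm{cvx}}$ for all $j\ge\bar j$.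
   Context: **System and constraints.** $x_{t+1}=Ax_t+Bu_t+w_t$ with $x_t\in\mathbb{R}^n$, $u_t\in\mathbb{R}^m$, $A,B$ known matrices, and $w_t$ i.i.d. random disturbances with known polytopic support $\mathbb{W}\subset\mathbb{R}^n$. The true constraint set is $\mathbb{Z}=\{(x,u):H_xx\le h_x,\ H_uu\le h_u\}$ (componentwise inequalities), where some rows of $(H_x,h_x)$ are unknown to the designer. **Iterations.** The system performs the same task repeatedly. Iteration $j\in\{1,2,\dots\}$ starts at the fixed state $x_0^j=x_S$ and runs for $T$ time steps, with realized states $x_0^j,\dots,x_T^j$. Iteration $j$ uses a constraint estimate $\hat{\mathbb{Z}}^j=\{(x,u):\hat H_x^jx\le\hat h_x^j,\ H_uu\le h_u\}$ in the MPC controller below. **MPC controller.** Let $N\ll T$ be the prediction horizon, $\ell$ and $Q$ positive definite stage and terminal costs, and $K$ a gain with $A+BK$ stable. At time $t$ of iteration $j$, with measured state $x_t^j$, the MPC problem is $$\min\ \sum_{k=t}^{t+N-1}\ell(\bar x_{k|t},v_{k|t})+Q(\bar x_{t+N|t})$$ over vectors $v_{k|t}\in\mathbb{R}^m$ and matrices $M_{k,l|t}\in\mathbb{R}^{m\times n}$ ($t\le l<k\le t+N-1$), subject to $\bar x_{k+1|t}=A\bar x_{k|t}+Bv_{k|t}$; $x_{k+1|t}=Ax_{k|t}+Bu_{k|t}+w_{k|t}$; $u_{k|t}=\sum_{l=t}^{k-1}M_{k,l|t}w_{l|t}+v_{k|t}$; $\hat H_x^jx_{k|t}\le\hat h_x^j$;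 $H_uu_{k|t}\le h_u$; $x_{t|t}=\bar x_{t|t}=x_t^j$; $x_{t+N|t}\in\hat{\mathcal X}_N^j$; all constraints holding for all $w_{k|t}\in\mathbb{W}$ and all $k=t,\dots,t+N-1$. The terminal set $\hat{\mathcal X}_N^j$ is the polyhedral $(T-N)$-step robust reachable set, under $u=Kx$, to the state constraints in $\hat{\mathbb{Z}}^j$; it has the properties that every $x\in\hat{\mathcal X}_N^j$ satisfies $(x,Kx)\in\hat{\mathbb{Z}}^j$, and for all $i=1,\dots,T-N$ and all $w_0,\dots,w_{i-1}\in\mathbb{W}$, the point $y=(A+BK)^ix+\sum_{\tilde i=0}^{i-1}(A+BK)^{i-\tilde i-1}w_{\tilde i}$ satisfies $\hat H_x^jy\le\hat h_x^j$ and $H_uKy\le h_u$. The applied input is $u_t^j=v_{t|t}^{j,\star}$, where $\star$ denotes the optimal solution, and the problem is solved again at time $t+1$ (receding horizon). **Standing assumption.** With $\hat{\mathbb{Z}}^j=\mathbb{Z}$, the MPC problem is feasible at all times $0\le t\le T-1$ given the initial state $x_S$, for all iterations; moreover the zero state satisfies the true state constraints: $H_x\mathbf{0}_{n\times1}\le h_x$. **Convex-hull estimate.** For $j\ge1$, let $\hat{\mathbf x}^j$ be the (finite) collection of all states $x_t^i$, $1\le i\le j$, $0\le t\le T$, realized in the first $j$ iterations that satisfy $H_xx\le h_x$. Define the polytope $$\hat{\mathcal P}^{j+1}_{\mathrm{cvx}}=\mathrm{conv}\big(\{\mathbf{0}_{n\times1}\}\cup\hat{\mathbf x}^j\big)=\{x:\hat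 H^{j+1}_{x,\mathrm{cvx}}x\le\hat h^{j+1}_{x,\mathrm{cvx}}\},$$ and $$\hat{\mathbb{Z}}^{j+1}_{\mathrm{cvx}}=\{(x,u):\hat H^{j+1}_{x,\mathrm{cvx}}x\le\hat h^{j+1}_{x,\mathrm{cvx}},\ H_uu\le h_u\}.$$ The states of iterations before $\bar j$ may have been generated with other constraint estimates.
   Formalization: The second claim assumes that in every iteration j ≥ j̄ the MPC problem has an optimal solution at each time t < T, not only feasibility at t = 0 of iteration j̄; feasibility at t = 0 does not imply this, and otherwise the realized states are undefined. *)

(* Defs.v *)
From HB Require Import structures.
From mathcomp Require Import all_boot all_order all_algebra.
From mathcomp Require Import complex.
From mathcomp Require Import classical_sets cardinality reals convex.

Set Implicit Arguments.
Unset Strict Implicit.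
Unset Printing Implicit Defensive.

Import Order.TTheory GRing.Theory Num.Theory.
Local Open Scope classical_set_scope.
Local Open Scope ring_scope.

(* Componentwise inequality. *)
Definition lecv (R : realType) (p : nat) (a b : 'cV[R]_p) : Prop :=
  forall i, a i ord0 <= b i ord0.

Definition convex_hull (R : realType) (n : nat) (S : set 'cV[R]_n) : set 'cV[R]_n :=
  smallest (@convex_set R 'cV[R]_n) S.

(* Nonempty: it is used for the support of a random vector. *)
Definition polytope (R : realType) (n : nat) (P : set 'cV[R]_n) : Prop :=
  exists S : set 'cV[R]_n, [/\ finite_set S, S !=set0 & P = convex_hull S].

(* Schur stability of z_{k+1} = F z_k: all complex eigenvalues of F lie in the
   open unit disc. *)
Definition stable (R : realType) (n : nat) (F : 'M[R]_n) : Prop :=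
  forall z : R[i], eigenvalue (map_mx (real_complex R) F) z -> `|z| < 1.

Definition posdef_stage (R : realType) (n m : nat)
    (l : 'cV[R]_n -> 'cV[R]_m -> R) : Prop :=
  l 0 0 = 0 /\ forall x u, (x, u) <> (0, 0) -> 0 < l x u.

Definition posdef_terminal (R : realType) (n : nat)
    (Q : 'cV[R]_n -> R) : Prop :=
  Q 0 = 0 /\ forall x, x <> 0 -> 0 < Q x.

Definition constraint_set (R : realType) (n m p q : nat)
    (Hx : 'M[R]_(p, n)) (hx : 'cV[R]_p) (Hu : 'M[R]_(q, m)) (hu : 'cV[R]_q) :
    set ('cV[R]_n * 'cV[R]_m) :=
  [set z | lecv (Hx *m z.1) hx /\ lecv (Hu *m z.2) hu].

(* The data of the control design that do not depend on the constraints. *)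
Record mpc (R : realType) (n m : nat) := Mpc {
  sysA : 'M[R]_n;
  sysB : 'M[R]_(n, m);
  dist : set 'cV[R]_n;                       (* disturbance support *)
  gain : 'M[R]_(m, n);                       (* terminal feedback u = K x *)
  horizon : nat;                             (* prediction horizon N *)
  duration : nat;                            (* task duration T *)
  stage_cost : 'cV[R]_n -> 'cV[R]_m -> R;
  terminal_cost : 'cV[R]_n -> R;
  init : 'cV[R]_n                            (* x_S *)
}.

(* Decision variables of one MPC problem, indexed by the offset from the
   current time t: [pv k] is v_{t+k|t} and [pM k l] is M_{t+k,t+l|t}.  Only the
   entries with l < k < N are ever used. *)
Record policy (R : realType) (n m : nat) := Policy {
  pv : nat -> 'cV[R]_m;
  pM : nat -> nat -> 'M[R]_(m, n)
}.

Definition input (R : realType) (n m : nat) (th : policy R n m)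
    (w : nat -> 'cV[R]_n) (k : nat) : 'cV[R]_m :=
  \sum_(0 <= l < k) pM th k l *m w l + pv th k.

(* Predicted state x_{t+k|t} from the measured state x0. *)
Fixpoint pred_state (R : realType) (n m : nat) (D : mpc R n m)
    (th : policy R n m) (x0 : 'cV[R]_n) (w : nat -> 'cV[R]_n) (k : nat) :
    'cV[R]_n :=
  if k is k'.+1
  then sysA D *m pred_state D th x0 w k' + sysB D *m input th w k' + w k'
  else x0.

(* Nominal predicted state: driven by the v_{t+k|t} only. *)
Fixpoint nominal_state (R : realType) (n m : nat) (D : mpc R n m)
    (th : policy R n m) (x0 : 'cV[R]_n) (k : nat) : 'cV[R]_n :=
  if k is k'.+1
  then sysA D *m nominal_state D th x0 k' + sysB D *m pv th k'
  else x0.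

Definition closed_matrix (R : realType) (n m : nat) (D : mpc R n m) : 'M[R]_n :=
  sysA D + sysB D *m gain D.

(* (T - N)-step robust reachable set under u = K x: the states that satisfy the
   constraints now and, for every disturbance sequence, during the next T - N
   steps. *)
Definition terminal_set (R : realType) (n m : nat) (D : mpc R n m)
    (Z : set ('cV[R]_n * 'cV[R]_m)) : set 'cV[R]_n :=
  [set x | Z (x, gain D *m x) /\
    forall (i : nat) (w : nat -> 'cV[R]_n),
      (1 <= i <= duration D - horizon D)%N ->
      (forall k, (k < i)%N -> dist D (w k)) ->
      let y := closed_matrix D ^+ i *m x
               + \sum_(0 <= k < i) closed_matrix D ^+ (i - k - 1) *m w k in
      Z (y, gain D *m y)].

Definition mpc_admissible (R : realType) (n m : nat) (D : mpc R n m)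
    (Z : set ('cV[R]_n * 'cV[R]_m)) (x0 : 'cV[R]_n) (th : policy R n m) : Prop :=
  forall w : nat -> 'cV[R]_n,
    (forall k, (k < horizon D)%N -> dist D (w k)) ->
    (forall k, (k < horizon D)%N -> Z (pred_state D th x0 w k, input th w k)) /\
    terminal_set D Z (pred_state D th x0 w (horizon D)).

Definition mpc_cost (R : realType) (n m : nat) (D : mpc R n m)
    (x0 : 'cV[R]_n) (th : policy R n m) : R :=
  \sum_(0 <= k < horizon D) stage_cost D (nominal_state D th x0 k) (pv th k)
  + terminal_cost D (nominal_state D th x0 (horizon D)).

Definition mpc_feasible (R : realType) (n m : nat) (D : mpc R n m)
    (Z : set ('cV[R]_n * 'cV[R]_m)) (x0 : 'cV[R]_n) : Prop :=
  exists th, mpc_admissible D Z x0 th.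

Definition mpc_optimal (R : realType) (n m : nat) (D : mpc R n m)
    (Z : set ('cV[R]_n * 'cV[R]_m)) (x0 : 'cV[R]_n) (th : policy R n m) : Prop :=
  mpc_admissible D Z x0 th /\
  forall th', mpc_admissible D Z x0 th' -> mpc_cost D x0 th <= mpc_cost D x0 th'.

(* [x 0], ..., [x L] are states realized from x_S by the receding-horizon
   controller using the constraints Z, for some disturbances in the support.
   Optimal solutions need not be unique; any of them may be applied. *)
Definition closed_loop (R : realType) (n m : nat) (D : mpc R n m)
    (Z : set ('cV[R]_n * 'cV[R]_m)) (L : nat) (x : nat -> 'cV[R]_n) : Prop :=
  x 0%N = init D /\
  forall t, (t < L)%N ->
    exists (th : policy R n m) (w : 'cV[R]_n),
      [/\ mpc_optimal D Z (x t) th, dist D w &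
          x t.+1 = sysA D *m x t + sysB D *m pv th 0%N + w].

(* States among x^i_t, 1 <= i <= j, 0 <= t <= T, that satisfy Hx x <= hx. *)
Definition safe_states (R : realType) (n p : nat)
    (Hx : 'M[R]_(p, n)) (hx : 'cV[R]_p) (T : nat)
    (x : nat -> nat -> 'cV[R]_n) (j : nat) : set 'cV[R]_n :=
  [set y | exists i t, [/\ (1 <= i <= j)%N, (t <= T)%N, y = x i t &
                           lecv (Hx *m y) hx]].

(* Main.v *)
(* The convex hull lies in the true state constraints because those are convex
   and contain 0 and all the recorded states.  Once the controller uses the hull
   as its constraint set, robust admissibility of the applied policies keeps
   every realized state, including the one after the last step, inside the hull;
   recording these states then no longer enlarges it. *)

Require Import Defs.
From mathcomp Require Import all_boot all_order all_algebra.
From mathcomp Require Import complex.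
From mathcomp Require Import interval_inference.
From mathcomp Require Import classical_sets cardinality reals convex.

Import Order.TTheory GRing.Theory Num.Theory.
Local Open Scope classical_set_scope.
Local Open Scope ring_scope.

Lemma convex_set_lecv_mulmx (R : realType) (n p : nat)
  (H : 'M[R]_(p, n)) (h : 'cV[R]_p) :
  convex_set ([set y | lecv (H *m y) h] : set 'cV[R]_n).
Proof.
move=> a b t; rewrite !inE /= => Ha Hb i.
have t0 : 0 <= (Itv.r t) by exact: ge0.
have t1 : (Itv.r t) <= 1 by exact: le1.
rewrite [conv t a b](_ : _ = Itv.r t *: (a : 'cV_n) + (1 - Itv.r t) *: (b : 'cV_n)) //.
rewrite mulmxDr -!scalemxAr mxE [X in X + _]mxE [X in _ + X]mxE -[leRHS]mul1r.
(* The bound is split with the same weights, [h = t h + (1 - t) h]. *)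
rewrite -[X in _ <= X * _](subrKC (Itv.r t)) [leRHS]mulrDl.
by apply: lerD; apply: ler_wpM2l; rewrite ?subr_ge0.
Qed.

Lemma convex_set_convex_hull (R : realType) (n : nat) (S : set 'cV[R]_n) :
  convex_set (convex_hull S).
Proof.
move=> a b t; rewrite !inE => Sa Sb A [cA SA].
by have := cA a b t; rewrite !inE; apply; [exact: Sa | exact: Sb].
Qed.

Lemma convex_hull_eq (R : realType) (n : nat) (S S' : set 'cV[R]_n) :
  S `<=` S' -> S' `<=` convex_hull S -> convex_hull S' = convex_hull S.
Proof.
move=> SS' S'h; apply/seteqP; split.
  exact: smallest_sub (convex_set_convex_hull _ _ S) S'h.
by apply: sub_smallest2r => //; exact: convex_set_convex_hull.
Qed.

Lemma polytope_neq0 (R : realType) (n : nat) (P : set 'cV[R]_n) :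
  polytope P -> P !=set0.
Proof. by case=> S [_ [w Sw] ->]; exists w; exact: sub_gen_smallest. Qed.

(** Admissibility quantifies over disturbances, so a point of [dist D] is needed to instantiate it.
    At offset 0 the sum in [input] is empty. *)
Lemma mpc_admissible_init (R : realType) (n m : nat) (D : mpc R n m)
  (Z : set ('cV[R]_n * 'cV[R]_m)) (x0 : 'cV[R]_n) (th : policy R n m) :
  (0 < horizon D)%N -> dist D !=set0 -> mpc_admissible D Z x0 th ->
  Z (x0, pv th 0%N).
Proof.
move=> N0 [w Dw] adm; have [/(_ 0%N N0) + _] := adm (fun=> w) (fun _ _ => Dw).
by rewrite /input big_geq // add0r.
Qed.

(** Under the constant sequence [w], the predicted state at offset 1 is the realized successor. *)
Lemma mpc_admissible_next (R : realType) (n m : nat) (D : mpc R n m)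
  (Z : set ('cV[R]_n * 'cV[R]_m)) (x0 w : 'cV[R]_n) (th : policy R n m) :
  (0 < horizon D)%N -> dist D w -> mpc_admissible D Z x0 th ->
  exists u, Z (sysA D *m x0 + sysB D *m pv th 0%N + w, u).
Proof.
move=> N0 Dw adm; have [] := adm (fun=> w) (fun _ _ => Dw).
have Epred : pred_state D th x0 (fun=> w) 1
    = sysA D *m x0 + sysB D *m pv th 0%N + w.
  by rewrite /= /input big_geq // add0r.
(* For N = 1 the successor state is constrained by the terminal set only. *)
have [N1|N1] := ltnP 1 (horizon D).
  by move=> /(_ 1%N N1) + _; rewrite Epred; eexists; eassumption.
have -> : horizon D = 1%N by apply/eqP; rewrite eqn_leq N1 N0.
by move=> _ [+ _]; rewrite Epred; eexists; eassumption.
Qed.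

(** Before time [L] the MPC problem solved at [t] constrains the measured state. None is solved at
    [L], so the last state is covered by the problem at [L - 1]. *)
Lemma closed_loop_constraint (R : realType) (n m : nat) (D : mpc R n m)
  (Z : set ('cV[R]_n * 'cV[R]_m)) (L : nat) (x : nat -> 'cV[R]_n) (t : nat) :
  (0 < horizon D)%N -> dist D !=set0 -> (0 < L)%N ->
  closed_loop D Z L x -> (t <= L)%N -> exists u, Z (x t, u).
Proof.
move=> N0 D0 L0 [_ step]; rewrite leq_eqVlt => /predU1P[->|tL].
  case: L L0 step => // L _ /(_ L (ltnSn L))[th [w [[adm _] Dw ->]]].
  exact: mpc_admissible_next.
have [th [_ [[adm _] _ _]]] := step t tL.
by exists (pv th 0%N); exact: mpc_admissible_init adm.
Qed.

Theorem proposition2 (R : realType) (n m p q : nat) (D : mpc R n m)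
  (Hx : 'M[R]_(p, n)) (hx : 'cV[R]_p) (Hu : 'M[R]_(q, m)) (hu : 'cV[R]_q)
  (distP : polytope (dist D))
  (horizonP : (0 < horizon D < duration D)%N)
  (stageP : posdef_stage (stage_cost D))
  (terminalP : posdef_terminal (terminal_cost D))
  (gainP : stable (closed_matrix D))
  (* standing assumption *)
  (true_feasible : forall (t : nat) (y : nat -> 'cV[R]_n),
     (t < duration D)%N ->
     closed_loop D (constraint_set Hx hx Hu hu) t y ->
     mpc_feasible D (constraint_set Hx hx Hu hu) (y t))
  (zero_safe : lecv (Hx *m 0) hx)
  (* x j t is the state realized at time t of iteration j >= 1 *)
  (x : nat -> nat -> 'cV[R]_n)
  (* half-space representations of the convex hulls *)
  (rc : nat -> nat) (Hc : forall j, 'M[R]_(rc j, n)) (hc : forall j, 'cV[R]_(rc j))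
  (hullP : forall j, (1 <= j)%N ->
     convex_hull ([set 0] `|` safe_states Hx hx (duration D) x j)
     = [set y | lecv (Hc j.+1 *m y) (hc j.+1)])
  (jbar : nat) (jbarP : (2 <= jbar)%N)
  (* iterations before jbar, with arbitrary constraint estimates *)
  (re : nat -> nat) (He : forall j, 'M[R]_(re j, n)) (he : forall j, 'cV[R]_(re j))
  (earlyP : forall j, (1 <= j < jbar)%N ->
     closed_loop D (constraint_set (He j) (he j) Hu hu) (duration D) (x j))
  (feasible0 :
     mpc_feasible D (constraint_set (Hc jbar) (hc jbar) Hu hu) (init D)) :
  constraint_set (Hc jbar) (hc jbar) Hu hu `<=` constraint_set Hx hx Hu hu /\
  ((forall j, (jbar <= j)%N ->
      closed_loop D (constraint_set (Hc j) (hc j) Hu hu) (duration D) (x j)) ->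
   forall j, (jbar <= j)%N ->
     constraint_set (Hc j) (hc j) Hu hu
     = constraint_set (Hc jbar) (hc jbar) Hu hu).
Proof.
have /andP[N0 NT] := horizonP.
have T0 := leq_trans N0 (ltnW NT).
have D0 := polytope_neq0 _ _ _ distP.
have hull_pred j : (2 <= j)%N ->
    convex_hull ([set 0] `|` safe_states Hx hx (duration D) x j.-1)
    = [set y | lecv (Hc j *m y) (hc j)].
  by case: j => [|[|j]] // _; exact: hullP.
split.
  move=> [y u] [/= Hy Hu_u]; split => //=.
  have : [set z | lecv (Hc jbar *m z) (hc jbar)] y by [].
  rewrite -(hull_pred _ jbarP).
  apply: (smallest_sub (convex_set_lecv_mulmx _ _ _ Hx hx)).
  by move=> z [->//|[i [t [_ _ _]]]].
move=> run.
(* The input constraints are common to all estimates, so only the state polyhedra matter. *)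
suff hull_const j : (jbar <= j)%N ->
    [set y | lecv (Hc j *m y) (hc j)]
    = [set y | lecv (Hc jbar *m y) (hc jbar)].
  move=> j jj; have /seteqP[sub sup] := hull_const j jj.
  by apply/seteqP; split=> -[y u] [/= Hy Hu_u]; split=> //=;
    [exact: sub | exact: sup].
(* Rewriting the right side by the induction hypothesis leaves two consecutive hulls to compare. *)
move=> /subnKC <-; elim: (j - jbar)%N => [|k <-]; first by rewrite addn0.
rewrite addnS; set i := (jbar + k)%N.
have ji : (jbar <= i)%N by exact: leq_addr.
have i2 : (2 <= i)%N := leq_trans jbarP ji.
rewrite -hullP; last exact: ltnW.
rewrite -(hull_pred _ i2); apply: convex_hull_eq => [y|y [y0|]].
- case=> [?|[i' [t [/andP[i'0 i'i] tT yE Hy]]]]; [by left|right].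
  exists i', t; split=> //; rewrite i'0 /=.
  exact: leq_trans i'i (leq_pred i).
- by apply: sub_gen_smallest; left.
(* Hull [i] records iterations up to [i - 1], so only the states of iteration [i] are new, and that
   iteration ran with hull [i] as its constraint. *)
case=> i' [t [/andP[i'0]]]; rewrite leq_eqVlt => /predU1P[->|i'i] tT yE Hy.
  have [u [Zy _]] :=
    closed_loop_constraint _ _ _ _ _ _ _ _ N0 D0 T0 (run i ji) tT.
  by rewrite (hull_pred _ i2) yE.
apply: sub_gen_smallest; right; exists i', t; split=> //.
by rewrite i'0 /= -ltnS prednK // ltnW.
Qed.
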